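(* There exists a $0$-crossing family $\mathcal F$ of demand functions such that every markdown policy $X=(X_t)_{t\in[n]}$ satisfies $$\mathrm{Reg}(X,\mathcal F)\ge\Omega(\log^2 n),$$ i.e. there are constants $c>0$ and $n_0$ such that for every $n\ge n_0$ and every markdown policy $X$ for horizon $n$, $\mathrm{Reg}(X,\mathcal F)\ge c\log^2 n$.
   Context: **Model.** Prices lie in $[0,1]$; the horizon is $n$ rounds. A demand function is a map $d:[0,1]\to[0,1]$, with revenue function $r(x)=x\,d(x)$. In round $t$ the seller chooses $X_t\in[0,1]$, measurable with respect to $\sigma(X_1,D_1,\dots,X_{t-1},D_{t-1})$ (a policy; it may depend on $n$ and on $\mathcal F$), and observes a random demand $D_t$ which, given $X_t=x$, is Bernoulli with mean $d(x)$, independent of the past. A policy is a markdown policy if $X_{t-1}\ge X_t$ almost surely for $t=2,\dots,n$. The regret is $\mathrm{Reg}(X,d)=n\max_{p\in[0,1]}p\,d(p)-\mathbb E[\sum_{t=1}^nX_td(X_t)]$ when the true demand function is $d$, and $\mathrm{Reg}(X,\mathcal F)=\sup_{d\in\mathcal F}\mathrm{Reg}(X,d)$. **Standing assumptions on families.** Each revenue function $r$ of a member of $\mathcal F$ is differentiable, has a unique maximizer $p^*$ on $[0,1]$, and $r'(p^* )=0$. **0-crossing family.** $\mathcal F$ is $0$-crossing if: (i) for every $p\in[0,1]$ the map $\Phi_p:\mathcal F\to\mathbb R$, $\Phi_p(d)=d(p)$, is injective; and (ii) there are $\Theta\subseteq\mathbb R$ and a bijection $\theta\mapsto d(\cdot;\theta)$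 from $\Theta$ onto $\mathcal F$ such that $\Theta$ is compact; $d:[0,1]\times\Theta\to\mathbb R$ is twice continuously differentiable; the map $p^*:\Theta\to[0,1]$ sending $\theta$ to the maximizer of $x\,d(x;\theta)$ is Lipschitz; and there is a constant $c_2>0$ such that for every $p\in[0,1]$ the inverse $\Phi_p^{-1}$, from the range of $\Phi_p$ to $\Theta$ (identifying $\mathcal F$ with $\Theta$), is $c_2$-Lipschitz. *)

(* Defs.v *)
(* MathComp-Analysis; the reals are an arbitrary R : realType. *)
From HB Require Import structures.
From mathcomp Require Import all_boot all_order all_algebra.
From mathcomp Require Import all_classical all_reals all_analysis.

Set Implicit Arguments.
Unset Strict Implicit.
Unset Printing Implicit Defensive.
Import Order.TTheory GRing.Theory Num.Theory.
Import numFieldNormedType.Exports.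

Local Open Scope classical_set_scope.
Local Open Scope ring_scope.

(* The unit interval as a type. It carries the subspace topology of R. *)
Definition unit_itv (R : realType) : set R := [set x | 0 <= x <= 1].
Arguments unit_itv : clear implicits.

Notation price R := (set_type (unit_itv R)).
Notation demand R := (price R -> price R).

Section Demand.
Variable R : realType.
Implicit Types (d : demand R) (F : set (demand R)).

Definition revenue d (x : price R) : R := val x * val (d x).

Definition maximizer d (p : price R) : Prop :=
  forall q, revenue d q <= revenue d p.

(* The punctured neighbourhoods are those of the subspace [0,1], so that the
   derivative is one-sided at the endpoints. *)
Definition has_derivative (r : price R -> R) (x : price R) (l : R) : Prop :=
  (fun y : price R => (r y - r x) / (val y - val x)) @ x^' --> l.

Definition regular_demand d : Prop :=
  [/\ forall x, exists l, has_derivative (revenue d) x l,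
      exists! p, maximizer d p
    & forall p, maximizer d p -> has_derivative (revenue d) p 0].

Definition C1_on (U : set (R^o * R^o)) (f : R^o * R^o -> R^o) : Prop :=
  forall v, v = (1, 0) \/ v = (0, 1) ->
    forall z, U z -> derivable f z v /\ {for z, continuous ('D_v f)}.

Definition C2_on (U : set (R^o * R^o)) (f : R^o * R^o -> R^o) : Prop :=
  [/\ C1_on U f, C1_on U ('D_(1, 0) f) & C1_on U ('D_(0, 1) f)].

(* A function on a set K that need not be open is C^2 when it extends to a
   C^2 function on an open neighbourhood of K; here K = [0,1] * Theta. *)
Definition C2_family (Theta : set R) (df : R -> demand R) : Prop :=
  exists (U : set (R^o * R^o)) (f : R^o * R^o -> R^o),
    [/\ open U, unit_itv R `*` Theta `<=` U, C2_on U f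
      & forall x theta, Theta theta -> f (val x, theta) = val (df theta x)].

Definition zero_crossing F : Prop :=
  (forall p : price R, {in F &, injective (fun d => d p)}) /\
  exists (Theta : set R) (df : R -> demand R),
    [/\ set_bij Theta F df,
        compact Theta,
        C2_family Theta df,
        (exists ps : R -> price R,
           (forall theta, Theta theta -> maximizer (df theta) (ps theta)) /\
           [lipschitz (val (ps theta) : R^o) | theta in (Theta : set R^o)])
      & exists2 c2 : R, 0 < c2 & forall p : price R,
          exists2 g : R^o -> R^o,
            (forall theta, Theta theta -> g (val (df theta p)) = theta)
          & c2.-lipschitz_[set val (df theta p) | theta in Theta] g].

End Demand.

Section Policy.
Variables (R : realType) (n : nat).

(* sigma(X_s, D_s : s < t); rounds are numbered from 0 and D_t = true is a
   sale. *)
Definition history d (Omega : measurableType d)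
    (X : 'I_n -> Omega -> price R) (D : 'I_n -> Omega -> bool) (t : 'I_n) :
    set (set Omega) :=
  <<s \bigcup_(s in [set s : 'I_n | (s < t)%N])
        (preimage_set_system setT (fun w => val (X s w) : R) measurable `|`
         preimage_set_system setT (D s) measurable) >>.

(* One family of random variables (X, D) on a measurable space, together with
   the law of the process under each demand function e of F. The last field
   says that, under law e, the conditional probability of D_t = 1 given the
   history up to t is e(X_t); that history determines X_t. *)
Record policy (F : set (demand R)) d (Omega : measurableType d) := Policy {
  posted : 'I_n -> Omega -> price R;
  demanded : 'I_n -> Omega -> bool;
  law : demand R -> probability Omega R;
  measurable_demanded : forall t, measurable_fun setT (demanded t);
  posted_adapted : forall t,
    preimage_set_system setT (fun w => val (posted t w) : R) measurable
      `<=` history posted demanded t;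
  demanded_bernoulli : forall e, F e -> forall (t : 'I_n) (A : set Omega),
    history posted demanded t A ->
    law e (A `&` [set w | demanded t w]) =
      (\int[law e]_(w in A) (val (e (posted t w)))%:E)%E
}.

Variables (F : set (demand R)) (d : measure_display)
  (Omega : measurableType d) (X : policy F Omega).

Definition markdown : Prop :=
  forall e, F e -> forall s t : 'I_n, t = s.+1 :> nat ->
    {ae law X e, forall w, val (posted X t w) <= val (posted X s w)}.

Definition regret (e : demand R) : \bar R :=
  ((n%:R * sup (range (revenue e)))%:E -
   'E_(law X e)[fun w => (\sum_(t < n) revenue e (posted X t w))%R])%E.

Definition worst_regret : \bar R := ereal_sup [set regret e | e in F].

End Policy.

(* Main.v *)
Require Import Defs.
From mathcomp Require Import all_boot all_order all_algebra.
From mathcomp Require Import all_classical all_reals all_analysis.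
From mathcomp Require Import measurable_realfun ring lra.

(* The family is d(x; th) = (th - x) / 2 with th in [5/4, 7/4]: the optimal price
   is th / 2, and pricing at x costs exactly (x - th / 2)^2 / 2.

   Let m be about n^(1/4) and take a round t in [m, m^2). If, for th = 5/4, the
   price at t is within g_t ~ sqrt(ln m / t) above the optimum with probability
   at least 1/2, then a chi-square change of measure shows that this event keeps
   a probability of order 1/m for th' = 5/4 + 4 g_t. The optimal price for th'
   is larger by 2 g_t, so a markdown policy is then stuck at least g_t below it
   for the remaining rounds and loses of order n g_t^2 / m, which is at least
   of order m ln m. Otherwise the policy loses of order g_t^2 in each of these
   rounds for th = 5/4, and the sum of ln m / t over [m, m^2) is of order
   (ln m)^2. *)

Set Implicit Arguments.
Unset Strict Implicit.
Unset Printing Implicit Defensive.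
Import Order.TTheory GRing.Theory Num.Theory.
Import numFieldNormedType.Exports.
Local Open Scope classical_set_scope.
Local Open Scope ring_scope.

(** * Linear demands: revenue, optimal price, regularity *)

Section LinearFamily.
Variable R : realType.
Implicit Types (y th : R) (x p : price R).

Lemma priceP x : 0 <= val x <= 1.
Proof. by case: x => x /= /set_mem. Qed.

Lemma clamp_subproof y : Num.max 0 (Num.min y 1) \in unit_itv R.
Proof.
by apply/mem_set; rewrite /unit_itv /= le_max lexx ge_max ler01 ge_min lexx orbT.
Qed.

(** Truncation makes demands and optimal prices total functions of a real parameter; for [th] in
    [parameters] it acts as the identity. *)
Definition clamp y : price R := SigSub (clamp_subproof y).

Lemma val_clamp y : 0 <= y <= 1 -> val (clamp y) = y.
Proof. by case/andP=> y0 y1; rewrite /= (min_idPl y1) (max_idPr y0). Qed.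

Definition linear_demand th : demand R := fun x => clamp ((th - val x) / 2).

(** On this interval every demand lies in [1/8, 7/8], which keeps the chi-square divergences
    bounded, and the optimum [th / 2] is interior. *)
Definition parameters : set R := `[5 / 4, 7 / 4]%classic.

Definition linear_family : set (demand R) := linear_demand @` parameters.

Lemma parametersP th : parameters th -> 5 / 4 <= th <= 7 / 4.
Proof. by rewrite /parameters /= in_itv. Qed.

Lemma linear_demandE th x :
  parameters th -> val (linear_demand th x) = (th - val x) / 2.
Proof.
move=> /parametersP th_itv; apply: val_clamp.
by have := priceP x; lra.
Qed.

Definition best_price th : price R := clamp (th / 2).

Lemma best_priceE th : parameters th -> val (best_price th) = th / 2.
Proof. by move=> /parametersP th_itv; apply: val_clamp; lra. Qed.

(** Completing the square in [x * (th - x) / 2]; the subtracted term is the loss from pricing at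
    [x]. *)
Lemma revenue_linear th x : parameters th ->
  revenue (linear_demand th) x = th ^+ 2 / 8 - (val x - th / 2) ^+ 2 / 2.
Proof. by move=> hth; rewrite /revenue linear_demandE//; field. Qed.

Lemma maximizer_best_price th :
  parameters th -> maximizer (linear_demand th) (best_price th).
Proof.
move=> hth q; rewrite !revenue_linear// best_priceE// subrr expr0n/= mul0r subr0.
by rewrite gerBl divr_ge0// sqr_ge0.
Qed.

Lemma maximizer_uniq th p :
  parameters th -> maximizer (linear_demand th) p -> p = best_price th.
Proof.
move=> hth /(_ (best_price th)); rewrite !revenue_linear// best_priceE//.
rewrite subrr expr0n/= mul0r subr0 => h; apply: val_inj; rewrite best_priceE//.
apply/eqP; rewrite -subr_eq0 -sqrf_eq0 eq_le sqr_ge0 andbT.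
by move: h; rewrite lerBrDl gerDr pmulr_lle0// invr_gt0.
Qed.

Lemma sup_revenue th :
  parameters th -> sup (range (revenue (linear_demand th))) = th ^+ 2 / 8.
Proof.
move=> hth; have best : revenue (linear_demand th) (best_price th) = th ^+ 2 / 8.
  by rewrite revenue_linear// best_priceE// subrr expr0n/= mul0r subr0.
apply/eqP; rewrite eq_le; apply/andP; split.
  apply: ge_sup; first by exists (th ^+ 2 / 8), (best_price th).
  by move=> _ [q _ <-]; rewrite -best; exact: maximizer_best_price.
apply: ub_le_sup; last by exists (best_price th).
exists (th ^+ 2 / 8) => _ [q _ <-]; rewrite -best; exact: maximizer_best_price.
Qed.

Lemma has_derivative_revenue th x : parameters th ->
  has_derivative (revenue (linear_demand th)) x (th / 2 - val x).
Proof.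
(* [g y] is the difference quotient of the revenue between [y] and [x] with [y - x] cancelled, so
   its continuity yields the limit. *)
move=> hth; pose g (y : R) := (th - y - val x) / 2.
have gx : g (val x) = th / 2 - val x by rewrite /g; field.
have cvg_g : g (val y) @[y --> x] --> th / 2 - val x.
  rewrite -gx; apply: (@continuous_comp (set_type (unit_itv R)) R R val g).
    exact: initial_continuous.
  apply: cvgM; last exact: cvg_cst.
  by apply: cvgB; [apply: cvgB; [exact: cvg_cst|exact: cvg_id]|exact: cvg_cst].
have cvg_g' : g (val y) @[y --> x^'] --> th / 2 - val x.
  exact: cvg_within_filter.
rewrite /has_derivative; apply: (cvg_trans _ cvg_g').
apply: near_eq_cvg; rewrite near_withinE; apply: nearW => y; rewrite /g => yx.
have yx0 : val y - val x != 0.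
  by rewrite subr_eq0 (inj_eq val_inj).
by rewrite !revenue_linear//; field.
Qed.

Lemma linear_family_regular e : linear_family e -> regular_demand e.
Proof.
case=> th hth <-; split.
- by move=> x; exists (th / 2 - val x); exact: has_derivative_revenue.
- exists (best_price th); split; first exact: maximizer_best_price.
  by move=> p /(maximizer_uniq hth).
- move=> p /(maximizer_uniq hth) ->.
  have -> : 0 = th / 2 - val (best_price th) by rewrite best_priceE// subrr.
  exact: has_derivative_revenue.
Qed.

End LinearFamily.

(** * The linear family is 0-crossing *)

Section ZeroCrossing.
Variable R : realType.

(** The difference quotient is constant for nonzero [h]. *)
Lemma is_derive_affine (a b c : R) (z v : R^o * R^o) :
  is_derive z v (fun u : R^o * R^o => a * u.1 + b * u.2 + c : R^o)
    (a * v.1 + b * v.2).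
Proof.
have cvg_q : h^-1 *: ((a * (h *: v + z).1 + b * (h *: v + z).2 + c) -
    (a * z.1 + b * z.2 + c)) @[h --> (0 : R)^'] --> (a * v.1 + b * v.2 : R^o).
  apply: cvg_near_cst; rewrite near_withinE; apply: nearW => h /= h0.
  by rewrite /GRing.scale /=; field.
by split; [exact: (cvgP _ cvg_q)|exact: (cvg_lim _ cvg_q)].
Qed.

Lemma C1_on_affine (U : set (R^o * R^o)) (a b c : R) :
  C1_on U (fun u : R^o * R^o => a * u.1 + b * u.2 + c : R^o).
Proof.
move=> v _ z _; split; first by have [] := is_derive_affine a b c z v.
have -> : 'D_v (fun u : R^o * R^o => a * u.1 + b * u.2 + c : R^o) =
    cst (a * v.1 + b * v.2).
  by apply/funext => u; have [_ ->] := is_derive_affine a b c u v.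
exact: cst_continuous.
Qed.

(** Directional derivatives of an affine map are constant, hence affine again. *)
Lemma C2_on_affine (U : set (R^o * R^o)) (a b c : R) :
  C2_on U (fun u : R^o * R^o => a * u.1 + b * u.2 + c : R^o).
Proof.
have C1D v : C1_on U ('D_v (fun u : R^o * R^o => a * u.1 + b * u.2 + c : R^o)).
  have -> : 'D_v (fun u : R^o * R^o => a * u.1 + b * u.2 + c : R^o) =
      fun u : R^o * R^o => 0 * u.1 + 0 * u.2 + (a * v.1 + b * v.2) : R^o.
    apply/funext => u; have [_ ->] := is_derive_affine a b c u v.
    by rewrite !mul0r !add0r.
  exact: C1_on_affine.
by split; [exact: C1_on_affine|exact: C1D|exact: C1D].
Qed.

Lemma linear_family_zero_crossing : zero_crossing (@linear_family R).
Proof.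
have inj p th th' : @parameters R th -> parameters th' ->
    val (linear_demand th p) = val (linear_demand th' p) -> th = th'.
  by move=> h h'; rewrite !linear_demandE// => E; lra.
split.
  move=> p _ _ /set_mem[th h <-] /set_mem[th' h' <-] /(congr1 val).
  by move/inj => ->.
exists (@parameters R), (@linear_demand R); split.
- split.
  + by move=> th h; exists th.
  + move=> th th' /set_mem h /set_mem h' E.
    by apply: (inj (clamp 0)) => //; rewrite E.
  + by [].
- exact: segment_compact.
- exists setT, (fun u : R^o * R^o => - 2^-1 * u.1 + 2^-1 * u.2 + 0 : R^o).
  split; [exact: openT|by []|exact: C2_on_affine|move=> x th h /=].
  by rewrite [RHS]linear_demandE// addr0 mulNr addrC -mulrBr mulrC.
- exists (@best_price R); split; first exact: maximizer_best_price.
  (* Any parameter would do here: it shows that the filter of pairs of parameters is proper. *)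
  have half : parameters (3 / 2 : R) by rewrite /parameters /= in_itv /=; lra.
  apply: (@klipschitzW _ _ _ 2^-1).
    exact: (@globally_properfilter _ _ (3 / 2, 3 / 2)).
  move=> -[th th'] [h h'].
  change (`|val (best_price th) - val (best_price th')| <= 2^-1 * `|th - th'|).
  rewrite !best_priceE// -mulrBl normrM [`|2^-1|]gtr0_norm ?invr_gt0//.
  by rewrite mulrC.
(* Solving [y = (th - p) / 2] for [th] gives the inverse, of slope 2. *)
- exists 2 => // p; exists (fun y => 2 * y + val p).
    by move=> th h; rewrite linear_demandE//; field.
  move=> [y y'] _ /=; rewrite opprD addrACA subrr addr0 -mulrBr normrM.
  by rewrite gtr0_norm.
Qed.

End ZeroCrossing.

(** * Histories as unions of demand cylinders *)

Lemma sigma_algebra_setI (T : Type) (C : set (set T)) :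
  sigma_algebra setT C -> setI_closed C.
Proof.
(* De Morgan, with the binary union written as a countable one: index 0 carries [A], all others
   carry [B]. *)
move=> [_ CD CU] A B CA CB; have -> : A `&` B =
    setT `\` \bigcup_i (if i == 0%N then setT `\` A else setT `\` B).
  apply/seteqP; split=> [v [Av Bv]|v [_ nAB]].
    by split=> // -[i _]; case: ifP => _ [].
  split; apply: contrapT => nv; apply: nAB.
    by exists 0%N.
  by exists 1%N.
by apply: (CD); apply: CU => i; case: ifP => _; exact: CD.
Qed.

Section PolicyHistory.
Variables (R : realType) (n : nat) (F : set (demand R)) (disp : measure_display).
Variables (Omega : measurableType disp) (X : policy n F Omega).
Implicit Types (t s : 'I_n) (A : set Omega) (w : Omega) (k : nat).

Local Notation hist := (history (posted X) (demanded X)).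

(** For [k = t] these are the atoms of the history before round [t]: the demands also determine the
    prices. *)
Definition cylinder k w : set Omega :=
  [set w' | forall s, (s < k)%N -> demanded X s w' = demanded X s w].

Lemma history_ind t (C : set (set Omega)) : sigma_algebra setT C ->
  (forall s (B : set R), (s < t)%N -> measurable B ->
     C ((fun w => val (posted X s w)) @^-1` B)) ->
  (forall s (B : set bool), (s < t)%N -> C (demanded X s @^-1` B)) ->
  hist t `<=` C.
Proof.
move=> saC CX CD; apply: smallest_sub => // A [s /= st] [|] [B mB <-];
  rewrite setTI; [exact: CX|exact: CD].
Qed.

Lemma history_posted t (B : set R) : measurable B ->
  hist t ((fun w => val (posted X t w)) @^-1` B).
Proof. by move=> mB; apply: posted_adapted; exists B => //; rewrite setTI. Qed.

Lemma history_demanded t s (b : bool) : (s < t)%N ->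
  hist t (demanded X s @^-1` [set b]).
Proof.
move=> st; apply: sub_sigma_algebra; exists s => //; right.
by exists [set b] => //; rewrite setTI.
Qed.

Lemma history_cylinder t k w : (k <= t)%N -> hist t (cylinder k w).
Proof.
have saH : sigma_algebra setT (hist t) by exact: smallest_sigma_algebra.
elim: k => [_|k IHk kt].
  have -> : cylinder 0 w = setT `\` set0 by rewrite setD0; apply/seteqP; split.
  by case: saH => h0 + _; exact.
pose s := Ordinal (ltn_trans kt (ltn_ord t)).
have -> : cylinder k.+1 w =
    cylinder k w `&` demanded X s @^-1` [set demanded X s w].
  apply/seteqP; split=> [v vw|v [vw vs] r].
    by split=> [r rk|]; apply: vw => //; exact: ltnW.
  rewrite ltnS leq_eqVlt => /orP[/eqP rk|]; last exact: vw.
  by have -> : r = s by exact: val_inj.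
apply: (sigma_algebra_setI saH); last exact: history_demanded.
by apply: IHk; exact: ltnW.
Qed.

(* Since the prices are adapted, the history is generated by the demands alone,
   so its sets are unions of cylinders. *)
Lemma history_saturated t A w w' :
  hist t A -> cylinder t w w' -> A w -> A w'.
Proof.
(* Strong induction on the round: the price of a round [s < t] lies in the history of [s], where
   saturation is already known. *)
move=> + + ; move: {2}(t : nat) (erefl (t : nat)) => k.
elim/ltn_ind: k t A w w' => k IHk t A w w' tk hA ww' Aw.
pose C : set (set Omega) :=
  [set B | forall v v', cylinder t v v' -> B v -> B v'].
have symm v v' : cylinder t v v' -> cylinder t v' v.
  by move=> vv' s st; rewrite vv'.
suff : C A by apply; eassumption.
apply: (history_ind _ _ _ hA).
- split.
  + by [].
  + by move=> B CB v v' /symm vv' [_ nBv]; split=> // /(CB _ _ vv').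
  + by move=> B CB v v' vv' [i _ Biv]; exists i => //; exact: CB vv' Biv.
- move=> s B st mB v v' vv'; apply: (IHk s _ s) => //; first by rewrite -tk.
    exact: history_posted.
  by move=> r rs; apply: vv'; exact: ltn_trans st.
- by move=> s B st v v' vv' /=; rewrite vv'.
Qed.

Lemma posted_cylinder t w w' : cylinder t w w' -> posted X t w' = posted X t w.
Proof.
move=> ww'; apply: val_inj.
have h := @history_posted t _ (measurable_set1 (val (posted X t w))).
exact: (history_saturated h ww').
Qed.

(** Demands are measurable by assumption; prices become so round by round, since each is adapted to
    the earlier rounds. *)
Lemma history_measurable t : hist t `<=` measurable.
Proof.
move: {2}(t : nat) (erefl (t : nat)) => k.
elim/ltn_ind: k t => k IHk t tk; apply: history_ind.
- exact: sigma_algebra_measurable.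
- move=> s B st mB; apply: (IHk s _ s) => //; first by rewrite -tk.
  exact: history_posted.
- move=> s B st; rewrite -[X in measurable X]setTI.
  exact: (measurable_demanded X s).
Qed.

Lemma measurable_posted t :
  measurable_fun setT (fun w => val (posted X t w)).
Proof.
move=> _ B mB; rewrite setTI; apply: (@history_measurable t).
exact: history_posted.
Qed.

End PolicyHistory.

(** * Comparing probabilities under two demand functions *)

Section ChangeOfMeasure.
Variables (R : realType) (n : nat) (F : set (demand R)) (disp : measure_display).
Variables (Omega : measurableType disp) (X : policy n F Omega).
Implicit Types (t s : 'I_n) (A B : set Omega) (w : Omega) (k : nat).
Implicit Types (e : demand R).

Local Notation hist := (history (posted X) (demanded X)).

Definition pr e A : R := fine (law X e A).

Lemma prE e A : measurable A -> law X e A = (pr e A)%:E.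
Proof. by move=> mA; rewrite /pr fineK// fin_num_measure. Qed.

Lemma pr_ge0 e A : 0 <= pr e A.
Proof. exact: fine_ge0. Qed.

Lemma pr_set0 e : pr e set0 = 0.
Proof. by rewrite /pr measure0. Qed.

Lemma pr_setT e : pr e setT = 1.
Proof. by rewrite /pr probability_setT. Qed.

Lemma pr_setIDC e A B : measurable A -> measurable B ->
  pr e A = pr e (A `&` B) + pr e (A `&` ~` B).
Proof.
move=> mA mB; have mC := measurableC mB.
apply: EFin_inj; rewrite EFinD -!prE//; [|exact: measurableI..].
rewrite -measureU; [|exact: measurableI|exact: measurableI|].
  by rewrite -setIUr setUv setIT.
by rewrite setIACA setICr setI0.
Qed.

Lemma le_pr e A B : measurable A -> measurable B -> A `<=` B -> pr e A <= pr e B.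
Proof.
by move=> mA mB AB; rewrite -lee_fin -!prE//; apply: le_measure => //; apply/mem_set.
Qed.

(** The price is constant on the cylinder, so the integral of the conditional sale probability is a
    product. *)
Lemma pr_sale e t w : F e ->
  pr e (cylinder X t w `&` [set w' | demanded X t w']) =
  val (e (posted X t w)) * pr e (cylinder X t w).
Proof.
move=> Fe; have hB := @history_cylinder _ _ _ _ _ X _ _ w (leqnn t).
have mB := history_measurable hB.
rewrite {1}/pr demanded_bernoulli//.
have -> : (\int[law X e]_(w' in cylinder X t w) (val (e (posted X t w')))%:E =
    \int[law X e]_(w' in cylinder X t w) (cst (val (e (posted X t w)))%:E w'))%E.
  by apply: eq_integral => w' /set_mem ww'; rewrite /= (posted_cylinder ww').
by rewrite integral_cst// fineM ?fin_num_measure.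
Qed.

Lemma pr_no_sale e t w : F e ->
  pr e (cylinder X t w `&` ~` [set w' | demanded X t w']) =
  (1 - val (e (posted X t w))) * pr e (cylinder X t w).
Proof.
move=> Fe.
have mB := history_measurable (@history_cylinder _ _ _ _ _ X _ _ w (leqnn t)).
have mD : measurable [set w' | demanded X t w'].
  rewrite -[X in measurable X]setTI.
  exact: (measurable_demanded X t measurableT (_ : measurable [set true])).
by rewrite mulrBl mul1r -pr_sale// (pr_setIDC e mB mD) [X in X - _]addrC addrK.
Qed.

Lemma cauchy_schwarz_step (a1 a0 b u v x y K : R) :
  0 < u -> 0 < v -> u + v <= K -> 0 <= b -> 0 <= x -> 0 <= y ->
  a1 ^+ 2 * b <= u * x -> a0 ^+ 2 * b <= v * y ->
  (a1 + a0) ^+ 2 * b <= K * (x + y).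
Proof.
move=> u0 v0 uvK b0 x0 y0 h1 h0.
apply: (@le_trans _ _ ((u + v) * (x + y))); last first.
  by rewrite ler_wpM2r// addr_ge0.
have h1' : a1 ^+ 2 / u * b <= x by rewrite mulrAC ler_pdivrMr// [x * u]mulrC.
have h0' : a0 ^+ 2 / v * b <= y by rewrite mulrAC ler_pdivrMr// [y * v]mulrC.
apply: (@le_trans _ _ ((u + v) * (a1 ^+ 2 / u * b + a0 ^+ 2 / v * b))).
  (* The defect in Cauchy-Schwarz is an explicit square. *)
  rewrite -subr_ge0; suff -> : (u + v) * (a1 ^+ 2 / u * b + a0 ^+ 2 / v * b) -
      (a1 + a0) ^+ 2 * b = (v * a1 - u * a0) ^+ 2 / (u * v) * b.
    by rewrite mulr_ge0// divr_ge0 ?sqr_ge0// mulr_ge0 // ltW.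
  by field; rewrite !lt0r_neq0.
by rewrite ler_wpM2l ?lerD// addr_ge0// ltW.
Qed.

Variables (e e' : demand R) (K : R).
Hypotheses (Fe : F e) (Fe' : F e').
Hypothesis e_bounds : forall x, 0 < val (e x) < 1.
Hypothesis e'_bounds : forall x, 0 < val (e' x) < 1.
(** The left side is one plus the chi-square divergence of the two Bernoulli laws, i.e. the second
    moment of the one-round likelihood ratio under [e']. *)
Hypothesis chi2_bound : forall x,
  val (e x) ^+ 2 / val (e' x) + (1 - val (e x)) ^+ 2 / (1 - val (e' x)) <= K.

Let K_ge0 : 0 <= K.
Proof.
apply: le_trans (chi2_bound (clamp 0)).
have /andP[p0 p1] := e'_bounds (clamp 0).
by rewrite addr_ge0// divr_ge0 ?sqr_ge0// ?subr_ge0 ltW.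
Qed.

(* Downward induction on [k]: one round splits the cylinder in two, and the
   two bounds recombine by the Cauchy-Schwarz inequality. *)
Lemma change_of_measure_cylinder t A k w : hist t A -> (k <= t)%N ->
  pr e (A `&` cylinder X k w) ^+ 2 * pr e' (cylinder X k w) <=
  K ^+ (t - k) * pr e' (A `&` cylinder X k w) * pr e (cylinder X k w) ^+ 2.
Proof.
move=> hA; move Ej : (t - k)%N => j; elim: j => [|j IHj] in k w Ej *=> kt.
  (* At [k = t] the cylinder is either contained in [A] or disjoint from it, by saturation. *)
  have -> : k = t by apply/eqP; rewrite eqn_leq kt -subn_eq0 Ej.
  rewrite expr0 mul1r; have [Aw|nAw] := pselect (A w).
    rewrite (_ : A `&` _ = cylinder X t w) 1?mulrC//.
    by apply: setIidr => w' ww'; exact: history_saturated ww' Aw.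
  have -> : A `&` cylinder X t w = set0.
    apply/seteqP; split=> // w' [Aw' ww']; apply: nAw.
    by apply: history_saturated hA _ Aw' => s st; rewrite ww'.
  by rewrite !pr_set0 expr0n/= !mul0r.
have kt' : (k < t)%N by rewrite -subn_gt0 Ej.
pose s := Ordinal (ltn_trans kt' (ltn_ord t)).
set B := cylinder X k w; set D := [set w' | demanded X s w'].
have mA : measurable A := history_measurable hA.
have mB : measurable B.
  exact: (history_measurable (@history_cylinder _ _ _ _ _ X _ _ w (leqnn s))).
have mD : measurable D.
  rewrite -[X in measurable X]setTI.
  exact: (measurable_demanded X s measurableT (_ : measurable [set true])).
pose Q (C : set Omega) := pr e (A `&` C) ^+ 2 * pr e' C <=
  K ^+ j * pr e' (A `&` C) * pr e C ^+ 2.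
have QI C (b : bool) : C = [set w' | demanded X s w' = b] -> Q (B `&` C).
  move=> ->; set G := B `&` _.
  (* A nonempty half is the cylinder of length [k.+1] around any of its points, so the induction
     hypothesis applies. *)
  have [->|/set0P[v [wv vb]]] := eqVneq G set0.
    by rewrite /Q setI0 !pr_set0 !mulr0 mul0r.
  have -> : G = cylinder X k.+1 v.
    apply/seteqP; split=> [w' [ww' w'b] r|w' vw'].
      rewrite ltnS leq_eqVlt => /orP[/eqP rk|rk].
        by rewrite (_ : r = s) ?w'b ?vb//; exact: val_inj.
      by rewrite ww'// wv.
    split; last by rewrite -vb; exact: (vw' s).
    by move=> r rk; rewrite vw' ?wv//; exact: ltnW.
  by apply: IHj => //; rewrite subnS Ej.
have /andP[p0 p1] := e_bounds (posted X s w).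
have /andP[q0 q1] := e'_bounds (posted X s w).
have := QI D true erefl; have := QI (~` D) false _; rewrite /Q.
rewrite /B !(pr_sale s w) // !(pr_no_sale s w)// !setIA -/B.
set p := val (e _) in p0 p1 *; set q := val (e' _) in q0 q1 *.
move=> H0 H1.
rewrite (pr_setIDC e (measurableI _ _ mA mB) mD).
rewrite (pr_setIDC e' (measurableI _ _ mA mB) mD).
rewrite [leRHS](_ : _ = K * (K ^+ j * pr e' (A `&` B `&` D) * pr e B ^+ 2 +
    K ^+ j * pr e' (A `&` B `&` ~` D) * pr e B ^+ 2)); last first.
  by rewrite exprS; ring.
(* The weights are the contributions of sale and no sale to the second moment bounded by [K]. *)
apply: (@cauchy_schwarz_step _ _ _ (p ^+ 2 / q) ((1 - p) ^+ 2 / (1 - q))).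
- by rewrite divr_gt0// exprn_gt0.
- by rewrite divr_gt0 ?exprn_gt0 ?subr_gt0.
- exact: chi2_bound.
- exact: pr_ge0.
- by rewrite !mulr_ge0 ?exprn_ge0// pr_ge0.
- by rewrite !mulr_ge0 ?exprn_ge0// pr_ge0.
- by rewrite [leRHS]mulrAC ler_pdivlMr//; move: H1; rewrite exprMn; lra.
- rewrite [leRHS]mulrAC ler_pdivlMr ?subr_gt0//.
  suff /H0 : ~` D = [set w' | demanded X s w' = false] by rewrite exprMn; lra.
  apply/seteqP; split=> w'; rewrite /D /setC /=.
    by case: demanded => // /(_ isT).
  by case: demanded.
Qed.

(** Cauchy-Schwarz for the likelihood ratio, whose second moment over [t] rounds is at most
    [K ^+ t]; the cylinder of length 0 is the whole space. *)
Lemma change_of_measure t A : hist t A -> pr e A ^+ 2 <= K ^+ t * pr e' A.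
Proof.
move=> hA; have [A0|/set0P[w Aw]] := eqVneq A set0.
  by rewrite A0 !pr_set0 expr0n mulr0.
have := change_of_measure_cylinder w hA (leq0n t).
have -> : cylinder X 0 w = setT by apply/seteqP; split.
by rewrite setIT !pr_setT expr1n !mulr1 subn0.
Qed.

End ChangeOfMeasure.

(** * Lower bounds on the regret for one linear demand *)

Section LinearRegret.
Variables (R : realType) (n : nat) (disp : measure_display).
Variables (Omega : measurableType disp) (X : policy n (@linear_family R) Omega).
Implicit Types (t s : 'I_n) (th : R).

Lemma measurable_revenue th t : parameters th ->
  measurable_fun setT (fun w => revenue (linear_demand th) (posted X t w)).
Proof.
move=> hth; under eq_fun do rewrite revenue_linear//.
apply: measurable_funB => //; apply: measurable_funM => //.
apply: measurable_funX; apply: measurable_funB => //.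
exact: measurable_posted.
Qed.

(** In each round revenue plus loss equals the optimum [th ^+ 2 / 8], and the loss dominates [a t]
    on [A t]; integrate the sum over rounds. *)
Lemma regret_ge th (a : 'I_n -> R) (A : 'I_n -> set Omega) :
  parameters th -> (forall t, 0 <= a t) -> (forall t, measurable (A t)) ->
  (forall t w, A t w -> a t <= (val (posted X t w) - th / 2) ^+ 2 / 2) ->
  ((\sum_(t < n) a t * pr X (linear_demand th) (A t))%:E <=
    regret X (linear_demand th))%E.
Proof.
move=> hth a0 mA aA; set e := linear_demand th; set P := law X e.
have rev0 t w : 0 <= revenue e (posted X t w).
  have [/andP[x0 _] /andP[y0 _]] :=
    (priceP (posted X t w), priceP (e (posted X t w))).
  exact: mulr_ge0.
pose S w := \sum_(t < n) revenue e (posted X t w).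
pose Z w := \sum_(t < n) a t * \1_(A t) w.
have S0 w : 0 <= S w by exact: sumr_ge0.
have Z0 w : 0 <= Z w by apply: sumr_ge0 => t _; rewrite mulr_ge0.
have mS : measurable_fun setT S.
  by apply: measurable_sum => t; exact: measurable_revenue.
have mZ : measurable_fun setT Z.
  apply: measurable_sum => t; apply: measurable_funM.
    exact: measurable_cst.
  by have := mA t; exact: measurable_indic.
have EZ : (\int[P]_w (Z w)%:E = (\sum_(t < n) a t * pr X e (A t))%:E)%E.
  under eq_integral do rewrite /Z -sumEFin.
  rewrite ge0_integral_sum//; last 2 first.
  - move=> t; apply/measurable_EFinP; apply: measurable_funM.
      exact: measurable_cst.
    exact: measurable_indic.
  - by move=> t w _; rewrite lee_fin mulr_ge0.
  rewrite -sumEFin; apply: eq_bigr => t _; under eq_integral do rewrite EFinM.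
  rewrite ge0_integralZl_EFin//; last first.
    by apply/measurable_EFinP; exact: measurable_indic.
  by rewrite integral_indic// setIT [RHS]EFinM /pr fineK ?fin_num_measure.
have SZ : (\int[P]_w (S w)%:E + \int[P]_w (Z w)%:E <= (n%:R * (th ^+ 2 / 8))%:E)%E.
  have mS' : measurable_fun setT (EFin \o S) by exact/measurable_EFinP.
  have mZ' : measurable_fun setT (EFin \o Z) by exact/measurable_EFinP.
  rewrite -ge0_integralD//; last 2 first.
  - by move=> w _; rewrite lee_fin.
  - by move=> w _; rewrite lee_fin.
  have -> : (n%:R * (th ^+ 2 / 8))%:E =
      (\int[P]_w (cst (n%:R * (th ^+ 2 / 8))%:E w))%E.
    rewrite integral_cst// -[LHS]mule1; congr (_ * _)%E.
    exact/esym/probability_setT.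
  apply: ge0_le_integral => //.
  - by move=> w _; rewrite -EFinD lee_fin addr_ge0.
  - exact: emeasurable_funD.
  - move=> w _; rewrite -EFinD lee_fin /S /Z -big_split/=.
    rewrite mulr_natl -[X in _ *+ X]card_ord -sumr_const.
    apply: ler_sum => t _; rewrite revenue_linear// -lerBrDl opprB addrC subrK.
    rewrite indicE; case: (asboolP (A t w)) => [Atw|nAtw].
      by rewrite mem_set// mulr1 aA.
    by rewrite memNset// mulr0 divr_ge0// sqr_ge0.
have EZ0 : (0 <= \int[P]_w (Z w)%:E)%E.
  by apply: integral_ge0 => w _; rewrite lee_fin.
rewrite -EZ /regret sup_revenue// unlock leeBrDr//; first by rewrite addeC.
(* Moving the expected revenue across the inequality requires it to be finite, which [SZ]
   provides. *)
rewrite ge0_fin_numE; last by apply: integral_ge0 => w _; exact: S0.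
apply: le_lt_trans (ltry (n%:R * (th ^+ 2 / 8))); apply: le_trans SZ.
exact: leeDl.
Qed.

(** Once at most [c], a markdown price almost surely stays there, and each of the [n - t] rounds
    from [t] on loses at least [d ^+ 2 / 2]. *)
Lemma regret_markdown_ge th t (c d : R) : markdown X -> parameters th ->
  0 <= d -> c + d <= th / 2 ->
  ((((n - t)%:R * (d ^+ 2 / 2)) *
     pr X (linear_demand th) [set w | val (posted X t w) <= c])%:E <=
    regret X (linear_demand th))%E.
Proof.
move=> mdX hth d0 cd; set e := linear_demand th.
pose A s := [set w | val (posted X s w) <= c].
have mA s : measurable (A s).
  have -> : A s = setT `&` (fun w => val (posted X s w)) @^-1` `]-oo, c].
    by rewrite setTI; apply/seteqP; split=> w; rewrite /A /= in_itv.
  exact: measurable_posted.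
have A_incr k (tk : (t <= k)%N) (kn : (k < n)%N) :
    pr X e (A t) <= pr X e (A (Ordinal kn)).
  elim: k tk kn => [|k IHk].
    rewrite leqn0 => /eqP t0 kn.
    by rewrite (_ : Ordinal kn = t)//; exact: val_inj.
  rewrite leq_eqVlt => /orP[/eqP tk kn|tk kn].
    by rewrite (_ : Ordinal kn = t)//; exact: val_inj.
  have kn' := ltnW kn; apply: (le_trans (IHk tk kn')).
  have [N [mN N0 subN]] := mdX e (imageP _ hth) (Ordinal kn') (Ordinal kn) erefl.
  rewrite (pr_setIDC X e (mA (Ordinal kn')) (mA (Ordinal kn))).
  have -> : pr X e (A (Ordinal kn') `&` ~` A (Ordinal kn)) = 0.
    apply/eqP; rewrite eq_le pr_ge0 andbT.
    have <- : pr X e N = 0 by rewrite /pr N0.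
    apply: le_pr => //; first by apply: measurableI => //; exact: measurableC.
    move=> w [Aw nAw]; apply: subN => /= decr; apply: nAw.
    exact: le_trans Aw.
  by rewrite addr0; apply: le_pr => //; exact: measurableI.
pose a s : R := if (t <= s)%N then d ^+ 2 / 2 else 0.
apply: le_trans (@regret_ge th a A _ _ mA _) => //.
- rewrite lee_fin; apply: (@le_trans _ _
    (\sum_(s < n | (t <= s)%N) d ^+ 2 / 2 * pr X e (A t))).
    rewrite -(big_geq_mkord t n xpredT (fun=> d ^+ 2 / 2 * pr X e (A t))).
    by rewrite sumr_const_nat -mulrA mulr_natl.
  rewrite [leRHS](bigID (fun s : 'I_n => (t <= s)%N))/=.
  rewrite -[leLHS]addr0 lerD//; last first.
    apply: sumr_ge0 => s _; rewrite mulr_ge0 ?pr_ge0// /a; case: ifP => // _.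
    by rewrite divr_ge0 ?sqr_ge0.
  apply: ler_sum => -[s sn] /= ts; rewrite /a /= ts.
  rewrite ler_wpM2l ?divr_ge0 ?sqr_ge0//.
  exact: A_incr.
- by move=> s; rewrite /a; case: ifP => // _; rewrite divr_ge0 ?sqr_ge0.
- move=> s w Asw; rewrite /a; case: ifP => _; last by rewrite divr_ge0 ?sqr_ge0.
  rewrite ler_wpM2r// -[leRHS]sqrrN ler_sqr ?nnegrE//; last first.
    by rewrite opprB; move: Asw; rewrite /A /=; lra.
  by rewrite opprB; move: Asw; rewrite /A /=; lra.
Qed.

End LinearRegret.

(** * The logarithmic-squared lower bound *)

Section LowerBound.
Variable R : realType.

Lemma linear_demand_chi2 (th th' : R) (x : price R) :
  parameters th -> parameters th' ->
  val (linear_demand th x) ^+ 2 / val (linear_demand th' x) +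
    (1 - val (linear_demand th x)) ^+ 2 / (1 - val (linear_demand th' x)) <=
  1 + 5 / 2 * (th' - th) ^+ 2.
Proof.
move=> hth hth'; have px := priceP x.
set p := val (linear_demand th x); set q := val (linear_demand th' x).
have /parametersP b := hth; have /parametersP b' := hth'.
have pE : p = (th - val x) / 2 by exact: linear_demandE.
have qE : q = (th' - val x) / 2 by exact: linear_demandE.
have q0 : 1 / 8 <= q by rewrite qE; lra.
have q1 : q <= 7 / 8 by rewrite qE; lra.
(* Since [q] lies in [1/8, 7/8], [q * (1 - q)] is at least 7/64; with [q - p = (th' - th) / 2] the
   factor is 16/7, below 5/2. *)
have -> : p ^+ 2 / q + (1 - p) ^+ 2 / (1 - q) =
    1 + (q - p) ^+ 2 / (q * (1 - q)).
  by field; apply/andP; split; [rewrite subr_eq0 gt_eqF//|rewrite gt_eqF//]; lra.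
have -> : th' - th = 2 * (q - p) by rewrite pE qE; field.
rewrite lerD2l ler_pdivrMr; last by rewrite mulr_gt0//; lra.
have : 0 <= (q - 1 / 8) * (7 / 8 - q) by rewrite mulr_ge0 // subr_ge0.
have := sqr_ge0 (q - p); nra.
Qed.

Lemma linear_demand_gt0_lt1 (th : R) (x : price R) :
  parameters th -> 0 < val (linear_demand th x) < 1.
Proof.
move=> hth; have px := priceP x; rewrite linear_demandE//.
by have := parametersP hth; lra.
Qed.

(** Telescoping of [ln (1 + 1 / t) <= 1 / t]. *)
Lemma ler_ln_sum_harmonic (m k : nat) : (0 < m)%N ->
  ln (m + k)%:R - ln m%:R <= \sum_(m <= t < m + k) (t%:R^-1 : R).
Proof.
move=> m0; elim: k => [|k IHk]; first by rewrite addn0 subrr big_geq.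
have mk0 : 0 < (m + k)%:R :> R by rewrite ltr0n addn_gt0 m0.
rewrite addnS big_nat_recr ?leq_addr//=; apply: le_trans (lerD IHk (lexx _)).
rewrite addrAC lerD2r -lerBlDl.
have -> : (m + k).+1%:R = (m + k)%:R * (1 + (m + k)%:R^-1) :> R.
  by rewrite mulrDr mulr1 divff ?gt_eqF// -natr1.
have V0 : 0 < (m + k)%:R^-1 :> R by rewrite invr_gt0.
rewrite lnM ?posrE ?addr_gt0//.
rewrite addrAC subrr add0r le_ln1Dx//; lra.
Qed.

Lemma biquadratic_floor (n : nat) : (16 <= n)%N ->
  exists2 m, (2 <= m)%N & (m ^ 4 <= n < m.+1 ^ 4)%N.
Proof.
elim: n => // n IHn; rewrite leq_eqVlt => /orP[/eqP <-|]; first by exists 2.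
rewrite ltnS => /IHn[m m2 /andP[mn nm]].
have [nm'|nm'] := ltnP n.+1 (m.+1 ^ 4)%N.
  by exists m; rewrite ?nm' ?(leqW mn).
exists m.+1; first exact: ltnW.
have -> : n.+1 = (m.+1 ^ 4)%N by apply/eqP; rewrite eqn_leq nm nm'.
by rewrite leqnn ltn_exp2r ?ltnSn.
Qed.

Section Horizon.
Variables (n m : nat) (disp : measure_display) (Omega : measurableType disp).
Variable X : policy n (@linear_family R) Omega.
Hypotheses (m2 : (2 <= m)%N) (m4n : (m ^ 4 <= n)%N) (mdX : markdown X).

Local Notation lam := (ln m%:R : R).

(* Chosen so that [(1 + 40 * gap t ^+ 2) ^+ t <= m]: with [t] observations, an
   event that is likely for one optimal price keeps a probability of order
   [1 / m] when that price is shifted by [2 * gap t]. *)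
Definition gap (t : nat) : R := Num.sqrt (lam / (64 * t%:R)).

Let m2R : 2 <= m%:R :> R. Proof. by rewrite (ler_nat R 2). Qed.
Let m0R : 0 < m%:R :> R. Proof. exact: lt_le_trans m2R. Qed.

Let lam_ge0 : 0 <= lam.
Proof. by rewrite ln_ge0// (le_trans _ m2R)// ler1n. Qed.

Let lam_le : lam <= m%:R.
Proof.
have : ln (1 + (m%:R - 1) : R) <= m%:R - 1 by apply: le_ln1Dx; have := m2R; lra.
by rewrite addrC subrK; lra.
Qed.

Let exp_lam : expR lam = m%:R. Proof. by rewrite lnK// posrE. Qed.

Let sqr_gap t : gap t ^+ 2 = lam / (64 * t%:R).
Proof. by rewrite sqr_sqrtr// divr_ge0// mulr_ge0. Qed.

Let gap_ge0 t : 0 <= gap t. Proof. exact: sqrtr_ge0. Qed.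

(** From [ln m <= m <= t]; it keeps [5 / 4 + 4 * gap t] at most 7/4, hence in [parameters]. *)
Let gap_le t : (m <= t)%N -> gap t <= 1 / 8.
Proof.
move=> mt; have mtR : m%:R <= t%:R :> R by rewrite ler_nat.
have t0 : 0 < t%:R :> R by exact: lt_le_trans mtR.
rewrite -(@ler_pXn2r _ 2)// ?nnegrE; [|exact: gap_ge0|lra].
rewrite sqr_gap ler_pdivrMr ?mulr_gt0//.
by have := le_trans lam_le mtR; lra.
Qed.

Let th0 : R := 5 / 4.
Let low t : set Omega := [set w | val (posted X t w) <= th0 / 2 + gap t].

Let measurable_low t : history (posted X) (demanded X) t (low t).
Proof.
have -> : low t = (fun w => val (posted X t w)) @^-1` `]-oo, th0 / 2 + gap t].
  by apply/seteqP; split=> w; rewrite /low /= in_itv.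
exact: history_posted.
Qed.

Let th0_par : parameters th0.
Proof. by rewrite /parameters /= in_itv /= /th0; lra. Qed.

Lemma regret_if_low (t : 'I_n) : (m <= t)%N -> (t < m ^ 2)%N ->
  1 / 2 <= pr X (linear_demand th0) (low t) ->
  ((lam ^+ 2 / 1024)%:E <= worst_regret X)%E.
Proof.
move=> mt tm half; pose th1 := th0 + 4 * gap t.
have g0 := gap_ge0 t; have g1 := gap_le mt.
have th1_par : parameters th1.
  by rewrite /parameters /= in_itv /= /th1 /th0; lra.
have mtR : m%:R <= t%:R :> R by rewrite ler_nat.
have t0 : 0 < t%:R :> R by exact: lt_le_trans mtR.
have tmR : t%:R <= m%:R ^+ 2 :> R by rewrite -natrX ler_nat ltnW.
(* The constant is 40 = 5/2 * 4^2, as [th1 - th0 = 4 * gap t]. *)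
have chi2 x : val (linear_demand th0 x) ^+ 2 / val (linear_demand th1 x) +
    (1 - val (linear_demand th0 x)) ^+ 2 / (1 - val (linear_demand th1 x)) <=
    1 + 40 * gap t ^+ 2.
  apply: le_trans (linear_demand_chi2 x th0_par th1_par) _.
  by rewrite /th1 addrAC subrr add0r exprMn; lra.
have := change_of_measure (imageP _ th0_par) (imageP _ th1_par)
  (fun x => linear_demand_gt0_lt1 x th0_par)
  (fun x => linear_demand_gt0_lt1 x th1_par) chi2 (@measurable_low t).
set q := pr X (linear_demand th1) _ => com.
have q0 : 0 <= q by exact: pr_ge0.
(* By [1 + u <= expR u] the power is at most the exponential of [40 / 64 * lam]. *)
have K_le : (1 + 40 * gap t ^+ 2) ^+ t <= m%:R.
  rewrite -exp_lam; apply: (@le_trans _ _ (expR (40 * gap t ^+ 2) ^+ t)).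
    rewrite lerXn2r ?nnegrE ?expR_ge0 ?expR_ge1Dx//.
    by rewrite addr_ge0// mulr_ge0// sqr_ge0.
  rewrite -expRM_natl ler_expR sqr_gap.
  have -> : t%:R * (40 * (lam / (64 * t%:R))) = 40 / 64 * lam.
    by field; rewrite gt_eqF.
  by have := lam_ge0; lra.
have q_ge : (4 * m%:R)^-1 <= q.
  rewrite -[leLHS]mul1r ler_pdivrMr ?mulr_gt0//.
  have : (1 / 2) ^+ 2 <= m%:R * q.
    apply: le_trans (le_trans com _); last by rewrite ler_wpM2r.
    by rewrite lerXn2r ?nnegrE// ?pr_ge0// divr_ge0.
  by lra.
apply: le_trans (le_trans (regret_markdown_ge t mdX th1_par g0
    (_ : th0 / 2 + gap t + gap t <= th1 / 2)) _); last 2 first.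
- by rewrite /th1; lra.
- by apply: ereal_sup_ubound; exists (linear_demand th1) => //; exact: imageP.
rewrite lee_fin -/(low t) -/q.
(* Here [n - t >= m^4 - m^2], and [m^2 >= 2]. *)
have n_t : m%:R ^+ 4 / 2 <= (n - t)%:R :> R.
  have tn : (t <= n)%N by exact/ltnW/ltn_ord.
  have nR : m%:R ^+ 4 <= n%:R :> R by rewrite -natrX ler_nat.
  have : 0 <= m%:R ^+ 2 * (m%:R ^+ 2 - 2) :> R.
    by rewrite mulr_ge0 ?sqr_ge0//; have := m2R; nra.
  by rewrite natrB//; lra.
have gap_ge : lam / (128 * m%:R ^+ 2) <= gap t ^+ 2 / 2.
  rewrite sqr_gap -mulrA ler_wpM2l// -invfM.
  rewrite lef_pV2 ?posrE ?mulr_gt0 ?exprn_gt0//.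
  by lra.
(* The product equals [m * lam / 1024], and [lam <= m]. *)
apply: (@le_trans _ _
    (m%:R ^+ 4 / 2 * (lam / (128 * m%:R ^+ 2)) * (4 * m%:R)^-1)).
  have -> : m%:R ^+ 4 / 2 * (lam / (128 * m%:R ^+ 2)) * (4 * m%:R)^-1 =
      m%:R * lam / 1024 by field; rewrite gt_eqF.
  have : lam ^+ 2 <= m%:R * lam by rewrite expr2 ler_wpM2r.
  by lra.
have h0 : 0 <= m%:R ^+ 4 / 2 :> R by rewrite divr_ge0 ?exprn_ge0.
have h1 : 0 <= lam / (128 * m%:R ^+ 2).
  by apply: divr_ge0 => //; apply: mulr_ge0 => //; exact: exprn_ge0.
have h2 : 0 <= (4 * m%:R)^-1 :> R by rewrite invr_ge0 mulr_ge0.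
exact: (ler_pM (mulr_ge0 h0 h1) h2 (ler_pM h0 h1 n_t gap_ge) q_ge).
Qed.

Lemma regret_if_never_low :
  (forall t : 'I_n, (m <= t)%N -> (t < m ^ 2)%N ->
    pr X (linear_demand th0) (low t) < 1 / 2) ->
  ((lam ^+ 2 / 256)%:E <= worst_regret X)%E.
Proof.
(* Only rounds in [m, m^2) are charged; there the price exceeds the optimum by more than [gap t]
   with probability above 1/2, giving [lam / (256 * t)]. *)
move=> nlow; pose a (t : 'I_n) : R :=
  if (t < m ^ 2)%N && (m <= t)%N then gap t ^+ 2 / 2 else 0.
have mlow t : measurable (low t) := history_measurable (@measurable_low t).
have g2 t : 0 <= gap t ^+ 2 / 2 by rewrite divr_ge0 ?sqr_ge0.
have a0 t : 0 <= a t by rewrite /a; case: ifP.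
have reg : ((\sum_(t < n) a t * pr X (linear_demand th0) (~` low t))%:E <=
    regret X (linear_demand th0))%E.
  apply: regret_ge => //; first by move=> t; exact: measurableC.
  move=> t w nlw; rewrite /a; case: ifP => _; last by rewrite divr_ge0 ?sqr_ge0.
  rewrite ler_wpM2r// lerXn2r ?nnegrE//.
    by move/negP: nlw; rewrite /low /= -ltNge; have := gap_ge0 t; lra.
  by move/negP: nlw; rewrite /low /= -ltNge; lra.
apply: le_trans (le_trans reg _); last first.
  by apply: ereal_sup_ubound; exists (linear_demand th0) => //; exact: imageP.
rewrite lee_fin; apply: (@le_trans _ _
    (\sum_(m <= t < m ^ 2) lam / 256 * t%:R^-1)).
  rewrite -mulr_sumr.
  have mm : (m <= m ^ 2)%N by rewrite -{1}[m]expn1 leq_exp2l// ltnW.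
  have := @ler_ln_sum_harmonic m (m ^ 2 - m) (ltnW m2); rewrite subnKC//.
  (* The harmonic sum is at least [ln (m ^ 2) - ln m = lam]. *)
  rewrite natrX lnXn// mulr2n addrK => harm.
  have -> : lam ^+ 2 / 256 = lam / 256 * lam by rewrite expr2 mulrAC.
  by apply: ler_wpM2l => //; apply: divr_ge0 => //; exact: ler0n.
have m2n : (m ^ 2 <= n)%N.
  by apply: leq_trans m4n; rewrite leq_exp2l// ltnW.
rewrite (big_nat_widen _ _ n)// big_geq_mkord/= big_mkcond/=.
apply: ler_sum => t _; rewrite /a; case: ifP => [/andP[tm mt]|]; last first.
  by rewrite mul0r.
have -> : lam / 256 * t%:R^-1 = gap t ^+ 2 / 2 * (1 / 2).
  rewrite sqr_gap !invfM; field.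
  by rewrite pnatr_eq0 -lt0n (leq_trans _ mt)// ltnW.
rewrite ler_wpM2l//.
have := pr_setIDC X (linear_demand th0) measurableT (mlow t).
by rewrite pr_setT !setTI; have := nlow t mt tm; lra.
Qed.

End Horizon.

Lemma worst_regret_ge (n : nat) (disp : measure_display)
    (Omega : measurableType disp) (X : policy n (@linear_family R) Omega) :
  (16 <= n)%N -> markdown X ->
  ((16^-1 ^+ 4 * ln n%:R ^+ 2)%:E <= worst_regret X)%E.
Proof.
move=> n16 mdX; have [m m2 /andP[mn nm]] := biquadratic_floor n16.
have m0 : 0 < m%:R :> R by rewrite ltr0n ltnW.
have n0 : 0 < n%:R :> R by rewrite ltr0n (leq_trans _ n16).
have lam0 : 0 <= ln m%:R :> R by rewrite ln_ge0// ler1n ltnW.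
have ln0 : 0 <= ln n%:R :> R by rewrite ln_ge0// ler1n (leq_trans _ n16).
(* [n < (m + 1)^4 <= (2 * m)^4 <= m^8], as [m >= 2]. *)
have n_m8 : (n <= m ^ 8)%N.
  apply: leq_trans (ltnW nm) _; rewrite -[8%N]/(2 * 4)%N expnM leq_exp2r//.
  rewrite (leq_trans _ (leq_mul m2 (leqnn m)))//.
  by rewrite mul2n -addnn -addn1 leq_add2l ltnW.
have L : ln n%:R <= 8 * ln m%:R :> R.
  rewrite mulr_natl -lnXn// ler_ln ?posrE ?exprn_gt0//.
  by rewrite -natrX ler_nat.
(* [16^-1 ^+ 4] is 2^-16, the product of 1/64 from [L] and 1/1024 from [regret_if_low], the weaker
   of the two cases. *)
have L2 : 16^-1 ^+ 4 * ln n%:R ^+ 2 <= ln m%:R ^+ 2 / 1024 :> R.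
  have : ln n%:R ^+ 2 <= (8 * ln m%:R) ^+ 2 :> R.
    by rewrite lerXn2r ?nnegrE// mulr_ge0.
  by rewrite exprMn; lra.
apply: (@le_trans _ _ (ln m%:R ^+ 2 / 1024)%:E); first by rewrite lee_fin.
have [[t [mt tm half]]|nlow] := pselect (exists t : 'I_n, [/\ (m <= t)%N,
    (t < m ^ 2)%N & 1 / 2 <= pr X (linear_demand (5 / 4))
      [set w | val (posted X t w) <= 5 / 4 / 2 + gap m t]]).
  exact: (regret_if_low m2 mn mdX mt tm half).
apply: le_trans (regret_if_never_low m2 mn _) => [|t mt tm].
  by rewrite lee_fin; have := sqr_ge0 (ln m%:R : R); lra.
by rewrite ltNge; apply/negP => half; apply: nlow; exists t.
Qed.

End LowerBound.

Theorem theorem3 (R : realType) :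
  exists F : set (demand R),
    [/\ forall d, F d -> regular_demand d,
        zero_crossing F
      & exists (c : R) (n0 : nat), 0 < c /\
          forall n : nat, (n0 <= n)%N ->
          forall (disp : measure_display) (Omega : measurableType disp)
            (X : policy n F Omega),
            markdown X -> ((c * ln n%:R ^+ 2)%:E <= worst_regret X)%E].
Proof.
exists (@linear_family R); split.
- exact: linear_family_regular.
- exact: linear_family_zero_crossing.
(* From [n >= 16] on, the integer fourth root is at least 2. *)
- exists (16^-1 ^+ 4), 16; split; first by rewrite exprn_gt0 ?invr_gt0.
  by move=> n n16 disp Omega X; exact: worst_regret_ge.
Qed.
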